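(* For every real $\alpha$ with $0<\alpha<\tfrac14$ there exists $k_0$ such that for all integers $k$ and $l$ satisfying $k\ge k_0$ and $k\le \alpha l$ we have \[ f(k,l)\le 2^{4k/(1-4\alpha)}. \]
   Context: For a graph $G$, write $G\rightarrow K_k$ if every coloring of the edges of $G$ with two colors yields a monochromatic copy of the complete graph $K_k$. For integers $k\ge 3$ and $l\ge k+1$, the relaxed Folkman number $f(k,l)$ is the minimum $n$ such that there exists a graph $G$ on $n$ vertices with $G\rightarrow K_k$ and $G$ containing no copy of $K_l$. *)

(* Defs.v *)
From mathcomp Require Import all_boot all_order all_algebra.

Set Implicit Arguments.
Unset Strict Implicit.
Unset Printing Implicit Defensive.

Record sgraph (T : finType) := SGraph {
  edge :> rel T;
  edge_sym : symmetric edge;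
  edge_irr : irreflexive edge }.

Definition is_clique (T : finType) (G : sgraph T) (A : {set T}) : Prop :=
  {in A &, forall x y, x != y -> G x y}.

Definition contains_K (T : finType) (G : sgraph T) (k : nat) : Prop :=
  exists A : {set T}, #|A| = k /\ is_clique G A.

(* An edge xy is the set [set x; y]. A colouring of the edges is a map on all
   subsets of T, of which only the values at the edges are used: every
   2-colouring of the edges of G extends to such a map. *)
Definition arrows (T : finType) (G : sgraph T) (k : nat) : Prop :=
  forall c : {set T} -> bool,
    exists (A : {set T}) (b : bool),
      [/\ #|A| = k, is_clique G A &
          {in A &, forall x y, x != y -> c [set x; y] = b}].

Definition folkman_order (k l n : nat) : Prop :=
  exists (T : finType) (G : sgraph T),
    [/\ #|T| = n, arrows G k & ~ contains_K G l].

(* n is the relaxed Folkman number f(k, l). The number is a relation, not a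
   function, so that no default value is needed: that f(k, l) exists for all
   k < l is Folkman's theorem. *)
Definition is_folkman_number (k l n : nat) : Prop :=
  folkman_order k l n /\ forall m, folkman_order k l m -> n <= m.

Lemma is_folkman_number_inj k l n m :
  is_folkman_number k l n -> is_folkman_number k l m -> n = m.
Proof.
move=> [nP nmin] [mP mmin]; apply/eqP.
by rewrite eqn_leq (nmin _ mP) (mmin _ nP).
Qed.

(* Main.v *)
Require Import Defs.
From mathcomp Require Import all_boot all_order all_algebra.
From mathcomp Require Import reals sequences exp.
From mathcomp Require Import ring lra zify boolp.
Import Order.TTheory GRing.Theory Num.Theory.
Local Open Scope ring_scope.

(** Put B = 2^(2/(1-4 alpha)), so that the bound is B^(2k) and B/4 = B^(4 alpha).
    Take a random graph with edge probability p = 24/(7B) on about B^(2k)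
    vertices. A first-moment bound excludes l-cliques, since p^l B^(4k) <=
    p^l (B/4)^l = (6/7)^l, and an exponential-moment bound shows that every
    vertex set U of size linear in k spans at least 2/3 of the expected number
    of edges, so that some vertex of U has at least (2p/3)(|U|-1) neighbours in
    U. Passing to its neighbours along the majority colour divides the size of
    U by about D = 3/p = 7B/8. Doing so 2k times produces a monochromatic k-clique,
    and there is room for it because (7/8)^(2k) decays faster than 1/k. *)

(** * Graphs read off from a map on vertex sets: degrees and edge counts *)

Definition pairs_in {T : finType} (U : {set T}) : {set {set T}} :=
  [set e : {set T} | e \subset U & #|e| == 2%N].

Definition pair_colour {T : finType} (c : {set T} -> bool) : rel T :=
  fun x y => (x != y) && c [set x; y].

Lemma pair_colour_sym {T : finType} (c : {set T} -> bool) :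
  symmetric (pair_colour c).
Proof. by move=> x y; rewrite /pair_colour eq_sym setUC. Qed.

Lemma pair_colour_irr {T : finType} (c : {set T} -> bool) :
  irreflexive (pair_colour c).
Proof. by move=> x; rewrite /pair_colour eqxx. Qed.

Definition graph_of {T : finType} (c : {set T} -> bool) : sgraph T :=
  SGraph (pair_colour_sym c) (pair_colour_irr c).

Definition edges_in {T : finType} (c : {set T} -> bool) (U : {set T}) :=
  [set e in pairs_in U | c e].

Definition nbhd {T : finType} (G : sgraph T) (U : {set T}) (v : T) : {set T} :=
  [set u in U | G v u].

(** Incidences of vertices and edges are counted in two ways: [u |-> [set v; u]] matches the
    neighbours of [v] with the edges through [v], and each edge has two ends. *)
Lemma sum_nbhd {T : finType} (c : {set T} -> bool) (U : {set T}) :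
  (\sum_(v in U) #|nbhd (graph_of c) U v| = 2 * #|edges_in c U|)%N.
Proof.
have deg v : v \in U -> #|nbhd (graph_of c) U v|
    = (\sum_(e in edges_in c U) (v \in e))%N.
  move=> vU.
  rewrite -big_mkcondr /= sum1dep_card.
  rewrite -(@card_in_imset _ _ (fun u => [set v; u])); last first.
    move=> u1 u2; rewrite !inE /= => /andP[_ /andP[n1 _]] /andP[_ /andP[n2 _]].
    move/setP/(_ u1); rewrite !inE eqxx orbT eq_sym (negPf n1) /=.
    by move/esym/eqP.
  apply: eq_card => e; rewrite inE; apply/imsetP/andP.
    case=> u; rewrite !inE /= => /andP[uU /andP[vu cu]] ->.
    rewrite cu !inE eqxx cards2 vu /=; split=> //.
    rewrite andbT; apply/andP; split=> //.
    by apply/subsetP => x; rewrite !inE => /orP[] /eqP ->.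
  rewrite !inE => -[/andP[/andP[sU /cards2P[a [b [ab eab]]]] ce] ve].
  move: ve sU; rewrite eab !inE => /orP[]/eqP vE sU; subst v.
    exists b => //; rewrite !inE /= /pair_colour ab -eab ce /= andbT.
    by apply: (subsetP sU); rewrite !inE eqxx orbT.
  exists a; last by rewrite setUC.
  rewrite !inE /= /pair_colour eq_sym ab setUC -eab ce /= andbT.
  by apply: (subsetP sU); rewrite !inE eqxx.
rewrite (eq_bigr _ deg) exchange_big /=.
rewrite (eq_bigr (fun=> 2%N)) ?sum_nat_const 1?mulnC // => e.
rewrite !inE => /andP[/andP[sU /eqP e2] _].
rewrite /= -e2 -sum1_card [RHS]big_mkcond /= [LHS]big_mkcond /=.
apply: eq_bigr => v _; case: ifP; first by case: (v \in e).
by move=> vU; case: ifP => // /(subsetP sU); rewrite vU.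
Qed.

Lemma card_pairs_in {T : finType} (U : {set T}) : #|pairs_in U| = 'C(#|U|, 2).
Proof. exact: cards_draws. Qed.

(** Averaging: if every vertex of [U] fell short, the degree sum would be below
    [d |U| (|U| - 1) = 2 d 'C(|U|, 2)], contradicting the handshake count. *)
Lemma exists_nbhd_ge (R : realFieldType) {T : finType} (c : {set T} -> bool)
    (U : {set T}) (d : R) :
    (0 < #|U|)%N -> d * 'C(#|U|, 2)%:R <= #|edges_in c U|%:R ->
  exists2 v, v \in U & d * (#|U|%:R - 1) <= #|nbhd (graph_of c) U v|%:R.
Proof.
move=> U0 dE; apply: contrapT => noV.
have lt v : v \in U -> #|nbhd (graph_of c) U v|%:R < d * (#|U|%:R - 1).
  by move=> vU; rewrite ltNge; apply/negP => le; apply: noV; exists v.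
have: \sum_(v in U) #|nbhd (graph_of c) U v|%:R < \sum_(v in U) d * (#|U|%:R - 1).
  have [u0 u0U] := card_gt0P U0.
  by apply: ltr_sum => //; apply/hasP; exists u0 => //; rewrite mem_index_enum.
rewrite -natr_sum sum_nbhd sumr_const -[X in _ < X]mulr_natr natrM.
have bin2E : 2 * 'C(#|U|, 2)%:R = #|U|%:R * (#|U|%:R - 1) :> R.
  rewrite -natrM mul_bin_left -[#|U|]prednK // !bin1 subn1 /= natrM mulrC.
  by rewrite -natr1 addrK.
nra.
Qed.

(** * The random graph and its union bound *)

Definition bern {R : pzRingType} (p : R) (b : bool) : R := if b then p else 1 - p.

(** Product measure: the values of [c] are independent Bernoulli variables, one for each subset of
    [T]. *)
Definition rg_weight {R : comPzRingType} {T : finType} (p : R)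
  (c : {ffun {set T} -> bool}) : R := \prod_e bern p (c e).

Lemma rg_weight_ge0 {R : realFieldType} {T : finType} (p : R)
    (c : {ffun {set T} -> bool}) : 0 <= p <= 1 -> 0 <= rg_weight p c.
Proof.
by move=> p01; apply: prodr_ge0 => e _; rewrite /bern; case: (c e); lra.
Qed.

(** Independence makes the expectation factor; each coordinate outside [E] contributes
    [p + (1 - p) = 1]. *)
Lemma rg_expectation {R : comPzRingType} {T : finType} (p : R)
    (E : {set {set T}}) (f : bool -> R) :
  \sum_(c : {ffun {set T} -> bool}) rg_weight p c * \prod_(e in E) f (c e)
  = (p * f true + (1 - p) * f false) ^+ #|E|.
Proof.
pose g (e : {set T}) b := bern p b * (if e \in E then f b else 1).
transitivity (\sum_(c : {ffun {set T} -> bool}) \prod_e g e (c e)).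
  apply: eq_bigr => c _; rewrite /rg_weight [X in _ * X]big_mkcond -big_split /=.
  by apply: eq_bigr.
rewrite -bigA_distr_bigA /= -prodr_const [RHS]big_mkcond.
apply: eq_bigr => e _; rewrite big_bool /g /=.
by case: ifP => // _; rewrite !mulr1 addrC subrK.
Qed.

Lemma rg_weight_sum {R : comPzRingType} (T : finType) (p : R) :
  \sum_(c : {ffun {set T} -> bool}) rg_weight p c = 1.
Proof.
have := rg_expectation p (@set0 {set T}) (fun=> 1); rewrite cards0 expr0 => <-.
by apply: eq_bigr => c _; rewrite big_set0 mulr1.
Qed.

(** Turns a bound with one factor per pair into one with a factor per vertex. As
    [2 'C(u, 2) = (u - 1) u], squaring both sides leaves a comparison of [u]-th powers. *)
Lemma expr_bin2_le {R : realFieldType} (q z : R) (u0 u : nat) :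
    0 <= q <= 1 -> 0 <= z -> (0 < u0 <= u)%N -> q ^+ u0.-1 <= z ^+ 2 ->
  q ^+ 'C(u, 2) <= z ^+ u.
Proof.
move=> /andP[q0 q1] z0 /andP[u00 u0u] qz.
rewrite -(@ler_pXn2r _ 2) ?nnegrE ?exprn_ge0 // -!exprM.
have -> : ('C(u, 2) * 2 = u.-1 * u)%N.
  by rewrite mulnC mul_bin_left bin1 subn1.
rewrite exprM [(u * 2)%N]mulnC exprM; apply: lerXn2r; rewrite ?nnegrE ?exprn_ge0 //.
by apply: le_trans qz; apply: ler_wiXn2l => //; lia.
Qed.

Lemma sum_expr_card {R : comPzRingType} (T : finType) (z : R) :
  \sum_(U : {set T}) z ^+ #|U| = (1 + z) ^+ #|T|.
Proof.
pose F (f : {ffun T -> bool}) := [set x | f x].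
rewrite (reindex F) /=; last first.
  exists (fun U : {set T} => [ffun x => x \in U]) => [f _ | U _].
    by apply/ffunP => x; rewrite ffunE inE.
  by apply/setP => x; rewrite inE ffunE.
transitivity (\sum_(f : {ffun T -> bool}) \prod_x (if f x then z else 1)).
  apply: eq_bigr => f _; rewrite -prodr_const big_mkcond /=.
  by apply: eq_bigr => x _; rewrite inE.
rewrite -(bigA_distr_bigA (fun (_ : T) (b : bool) => if b then z else 1)) /=.
by rewrite (eq_bigr (fun=> 1 + z)) ?prodr_const // => x _; rewrite big_bool addrC.
Qed.

Lemma clique_pairs_in {T : finType} (c : {set T} -> bool) (U : {set T}) :
  is_clique (graph_of c) U -> {in pairs_in U, forall e, c e}.
Proof.
move=> cl e; rewrite inE => /andP[sU /cards2P[a [b [ab eab]]]].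
have aU : a \in U by apply: (subsetP sU); rewrite eab !inE eqxx.
have bU : b \in U by apply: (subsetP sU); rewrite eab !inE eqxx orbT.
by have /andP[_] := cl _ _ aU bU ab; rewrite eab.
Qed.

(** With [z = 1/(4n)], Bernoulli's inequality gives [(1 - z)^n >= 3/4], and
    [(1 + z)^n (1 - z)^n <= 1], so [(1 + z)^n <= 4/3]. *)
Lemma union_bound_lt1 {R : realType} (n : nat) : (0 < n)%N ->
  2 * ((1 + (4 * n%:R)^-1) ^+ n - 1) < 1 :> R.
Proof.
move=> n0; set z : R := (4 * n%:R)^-1.
have nz : z *+ n = 1 / 4.
  by rewrite /z -mulr_natr; field; rewrite pnatr_eq0 -lt0n.
have z0 : 0 <= z by rewrite invr_ge0 mulr_ge0.
have z1 : z <= 1 / 4 by rewrite -nz -[n]prednK // mulrS lerDl mulrn_wge0.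
have bern_ineq : 1 - 1 / 4 <= (1 - z) ^+ n.
  rewrite -nz; elim: (n) => [|m IH]; first by rewrite mulr0n subr0.
  rewrite exprS mulrS; have zm : 0 <= z *+ m by rewrite mulrn_wge0.
  have : (1 - z) * (1 - z *+ m) <= (1 - z) * (1 - z) ^+ m.
    by apply: ler_wpM2l => //; lra.
  have : 0 <= z * (z *+ m) by rewrite mulr_ge0.
  lra.
have prod1 : (1 + z) ^+ n * (1 - z) ^+ n <= 1.
  rewrite -exprMn; apply: exprn_ile1; nra.
have : 1 <= (1 + z) ^+ n by apply: exprn_ege1; lra.
nra.
Qed.

(* Each vertex set U is bad with probability at most 2 z^|U|, where z = 1/(4n), and
   these bounds add up to 2 ((1 + z)^n - 1) < 1 over the nonempty sets U. *)
Lemma exists_clique_free_dense {R : realType} (T : finType) (p y : R)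
    (l s : nat) :
    (0 < #|T|)%N -> (0 < l)%N -> (0 < s)%N ->
    0 <= p <= 1 -> expR (p / 3) * (1 - p + p * expR (- (1 / 2))) <= y <= 1 ->
    p ^+ l.-1 * (4 * #|T|%:R) ^+ 2 <= 1 -> y ^+ s.-1 * (4 * #|T|%:R) ^+ 2 <= 1 ->
  exists c : {set T} -> bool, ~ contains_K (graph_of c) l /\
    forall U : {set T}, (s <= #|U|)%N ->
      2 * p / 3 * 'C(#|U|, 2)%:R <= #|edges_in c U|%:R.
Proof.
move=> n0 l0 s0 p01 /andP[yge y1] pl ys.
set z : R := (4 * #|T|%:R)^-1.
have n4 : (0 : R) < 4 * #|T|%:R by rewrite mulr_gt0 ?ltr0n.
have z0 : 0 <= z by rewrite invr_ge0 ltW.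
have toz x : x * (4 * #|T|%:R) ^+ 2 <= 1 -> x <= z ^+ 2.
  by rewrite -ler_pdivlMr ?exprn_gt0 // mul1r /z exprVn.
pose w := 1 - p + p * expR (- (1 / 2)).
have w0 : 0 <= w.
  by have := expR_ge0 (- (1 / 2) : R); rewrite /w; nra.
have y0 : 0 <= y by apply: le_trans yge; rewrite mulr_ge0 ?expR_ge0.
(* [F1] is the indicator of a clique on [U]. [F2] is [exp(p N / 3 - X / 2)], with [N] the number of
   pairs and [X] of edges in [U], so it is at least 1 when [X <= 2 p N / 3]. *)
pose F1 (c : {set T} -> bool) (U : {set T}) : R :=
  \prod_(e in pairs_in U) (c e)%:R.
pose tilt (b : bool) : R := if b then expR (- (1 / 2)) else 1.
pose F2 (c : {set T} -> bool) (U : {set T}) : R :=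
  expR (p / 3) ^+ 'C(#|U|, 2) * \prod_(e in pairs_in U) tilt (c e).
pose F c := \sum_(U : {set T}) ((if #|U| == l then F1 c U else 0) +
                                (if (s <= #|U|)%N then F2 c U else 0)).
have F1_ge0 c U : 0 <= F1 c U by apply: prodr_ge0.
have tilt_ge0 b : 0 <= tilt b by rewrite /tilt; case: b => //; exact: expR_ge0.
have F2_ge0 c U : 0 <= F2 c U.
  by rewrite mulr_ge0 ?exprn_ge0 ?expR_ge0 //; apply: prodr_ge0.
apply: contrapT => noc.
(* If no [c] is good, some [U] is bad for each [c]; then [F] has expectation at least 1, and the
   rest bounds it below 1. *)
have Fge1 c : 1 <= F c.
  have [U HU] : exists U : {set T}, 1 <= (if #|U| == l then F1 c U else 0) +
                                (if (s <= #|U|)%N then F2 c U else 0).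
    apply: contrapT => noU; apply: noc; exists c; split.
      move=> [U [Ul Ucl]]; apply: noU; exists U; rewrite Ul eqxx.
      rewrite /F1 big1 => [|e /(clique_pairs_in _ _ Ucl) -> //].
      by rewrite lerDl; case: ifP.
    move=> U sU; rewrite leNgt; apply/negP => lt; apply: noU; exists U.
    rewrite sU; apply: (@le_trans _ _ (F2 c U)); last by rewrite lerDr; case: ifP.
    rewrite /F2; have -> : \prod_(e in pairs_in U) tilt (c e) =
        expR (- (1 / 2)) ^+ #|edges_in c U|.
      rewrite -prodr_const big_mkcond [RHS]big_mkcond /=; apply: eq_bigr => e _.
      by rewrite [in RHS]inE /tilt; case: ifP.
    rewrite -!expRM_natl -expRD -[X in X <= _]expR0 ler_expR.
    lra.
  rewrite /F (bigD1 U) //= -[X in X <= _]addr0; apply: lerD => //.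
  by apply: sumr_ge0 => V _; apply: addr_ge0; case: ifP.
have : 1 <= \sum_(c : {ffun {set T} -> bool}) rg_weight p c * F c.
  rewrite -(rg_weight_sum T p); apply: ler_sum => c _.
  by rewrite -[X in X <= _]mulr1; apply: ler_wpM2l; rewrite ?rg_weight_ge0.
apply/negP; rewrite -ltNge.
apply: le_lt_trans (union_bound_lt1 _ n0).
(* The subtracted 1 is the term of the empty set, which contributes 0 to [F] because [l] and [s] are
   positive. *)
rewrite -/z -sum_expr_card (bigD1 set0) //= cards0 expr0 addrC addrK mulr_sumr.
under eq_bigr => c _ do rewrite /F mulr_sumr.
rewrite exchange_big /= (bigD1 set0) //= cards0 [in X in X + _]big1; last first.
  move=> c _; rewrite eq_sym eqn0Ngt l0 leqNgt s0 /=.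
  by rewrite addr0 mulr0.
rewrite add0r; apply: ler_sum => U U0.
under eq_bigr => c _ do rewrite mulrDr.
rewrite big_split /= mulr2n mulrDl mul1r; apply: lerD.
  case: eqP => [Ul|_]; last by rewrite big1 ?exprn_ge0 // => c _; rewrite mulr0.
  rewrite (rg_expectation p (pairs_in U) (fun b => b%:R)) mulr1 mulr0 addr0.
  rewrite card_pairs_in; apply: (@expr_bin2_le _ _ _ l) => //; last exact: toz.
  by rewrite l0 Ul leqnn.
have [sU|_] := boolP (s <= #|U|)%N; last first.
  by rewrite big1 ?exprn_ge0 // => c _; rewrite mulr0.
under eq_bigr => c _ do rewrite mulrCA.
rewrite -mulr_sumr (rg_expectation p (pairs_in U) tilt) card_pairs_in /tilt.
rewrite mulr1 [_ + (1 - p)]addrC -exprMn.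
apply: (@le_trans _ _ (y ^+ 'C(#|U|, 2))).
  by apply: lerXn2r; rewrite ?nnegrE // mulr_ge0 ?expR_ge0.
apply: (@expr_bin2_le _ _ _ s); rewrite ?y0 ?s0 //; exact: toz.
Qed.

(** * Monochromatic cliques in graphs with dense vertex sets *)

(** Erdős-Szekeres induction on [i + j]: pick a vertex of large degree in [U], keep its neighbours
    along one colour, and lower the target of that colour. The factor [M] keeps the sets above the
    size [s] at which density is available. *)
Lemma mono_clique_of_dense {R : realFieldType} {T : finType} (G : sgraph T)
    (D M : R) (s : nat) (chi : {set T} -> bool) :
    2 <= D -> s%:R <= M - 1 ->
    (forall U : {set T}, (s <= #|U|)%N -> (0 < #|U|)%N ->
       exists2 v, v \in U & 2 * (#|U|%:R - 1) <= D * #|nbhd G U v|%:R) ->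
  forall (i j : nat) (U : {set T}), D ^+ (i + j) * M - 1 <= #|U|%:R ->
    exists (A : {set T}) (b : bool),
      [/\ A \subset U, #|A| = (if b then i else j), is_clique G A &
          {in A &, forall x y, x != y -> chi [set x; y] = b}].
Proof.
move=> D2 sM dense.
have nil b i j (U : {set T}) : (if b then i else j) = 0%N ->
    exists (A : {set T}) (b : bool),
      [/\ A \subset U, #|A| = (if b then i else j), is_clique G A &
          {in A &, forall x y, x != y -> chi [set x; y] = b}].
  by move=> ij0; exists set0, b; rewrite cards0 ij0; split=> // [|x|x];
     rewrite ?sub0set ?inE.
have M1 : 1 <= M by have := ler0n R s; lra.
move=> i j; move mE : (i + j)%N => m; elim: m i j mE => [|m IH] i j mE U HU.
  by apply: (nil true); lia.
case: (posnP i) => [i0|i0]; first by apply: (nil true).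
case: (posnP j) => [j0|j0]; first by apply: (nil false).
have Dm : 1 <= D ^+ m by apply: exprn_ege1; lra.
rewrite exprS in HU.
have PM : 2 * M <= D * D ^+ m * M by apply: ler_wpM2r; nra.
have U1 : s%:R <= #|U|%:R :> R.
  by apply: le_trans sM _; apply: le_trans HU; lra.
have U2 : (0 < #|U|)%N.
  rewrite -(ltr0n R); apply: lt_le_trans HU; lra.
rewrite ler_nat in U1; have [v vU dv] := dense U U1 U2.
pose N b := [set u in nbhd G U v | chi [set v; u] == b].
have NE : (#|nbhd G U v| = #|N true| + #|N false|)%N.
  rewrite -(cardsID (N true) (nbhd G U v)); congr (_ + _)%N; apply: eq_card => u;
  by rewrite !inE; case: (u \in U); case: (G v u); case: (chi _).
have [b Nb] : exists b, D ^+ m * M - 1 <= #|N b|%:R.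
  have [Nt|Nt] := leP (D ^+ m * M - 1) #|N true|%:R; first by exists true.
  exists false; rewrite leNgt; apply/negP => Nf.
  move: dv; rewrite NE natrD.
  have : D * (#|N true|%:R + #|N false|%:R) <= D * (2 * (D ^+ m * M - 1)).
    by apply: ler_wpM2l; lra.
  (* The loss of 1 at each step is absorbed because [2 <= D]. *)
  nra.
have sNU : N b \subset U.
  by apply/subsetP => u; rewrite !inE => /andP[/andP[]].
have ext (A : {set T}) k : A \subset N b -> #|A| = k -> is_clique G A ->
    {in A &, forall x y, x != y -> chi [set x; y] = b} ->
    [/\ v |: A \subset U, #|v |: A| = k.+1, is_clique G (v |: A) &
      {in v |: A &, forall x y, x != y -> chi [set x; y] = b}].
  move=> sA Ak clA chA.
  have Av u : u \in A -> G v u /\ chi [set v; u] = b.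
    by move=> /(subsetP sA); rewrite !inE => /andP[/andP[_ ->] /eqP].
  split.
  - by rewrite subUset sub1set vU (subset_trans sA).
  - rewrite cardsU1 Ak; case: (boolP (v \in A)) => // /Av[].
    by rewrite edge_irr.
  - move=> x y; rewrite !inE => /orP[/eqP ->|xA] /orP[/eqP ->|yA].
    + by rewrite eqxx.
    + by case: (Av y yA).
    + by rewrite edge_sym; case: (Av x xA).
    + exact: clA.
  - move=> x y; rewrite !inE => /orP[/eqP ->|xA] /orP[/eqP ->|yA].
    + by rewrite eqxx.
    + by case: (Av y yA).
    + by rewrite setUC; case: (Av x xA).
    + exact: chA.
have ij : ((if b then i.-1 else i) + (if b then j else j.-1) = m)%N.
  by case: (b); lia.
have [A [b' [sA Ak clA chA]]] := IH _ _ ij _ Nb.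
(* A clique of the other colour already has its full size; one of colour [b] is one short and is
   completed by [v]. *)
have [bb|bb] := eqVneq b' b; last first.
  exists A, b'; split=> //; first exact: subset_trans sA sNU.
  by rewrite Ak; case: (b') (b) bb => [] [].
rewrite bb in Ak chA.
have [H1 H2 H3 H4] := ext _ _ sA Ak clA chA.
by exists (v |: A), b; split=> //; rewrite H2; case: (b); rewrite prednK.
Qed.

(** * Numerical estimates *)

(** The induction runs on the sharper bound [1 - x^m], that is, [m x^m <= 1 + x + ... + x^(m-1)]
    times [1 - x]. *)
Lemma natr_mul_expr_le1 {R : realFieldType} (x : R) (m : nat) :
  0 <= x <= 1 -> m%:R * x ^+ m * (1 - x) <= 1.
Proof.
move=> /andP[x0 x1]; apply: (@le_trans _ _ (1 - x ^+ m)); last first.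
  by rewrite gerBl exprn_ge0.
elim: m => [|m IH]; first by rewrite !mul0r expr0 subrr.
have xm : 0 <= x ^+ m by rewrite exprn_ge0.
rewrite -natr1 exprS.
have : x * (m%:R * x ^+ m * (1 - x)) <= m%:R * x ^+ m * (1 - x).
  by rewrite ler_piMl // !mulr_ge0 // subr_ge0.
have : 0 <= x ^+ m * (1 - x) ^+ 2 by rewrite mulr_ge0 ?exprn_ge0 ?subr_ge0.
nra.
Qed.

Lemma expr_eventually_le {R : realType} (x d : R) :
  0 <= x < 1 -> 0 < d -> exists k0, forall k, (k0 <= k)%N -> x ^+ k <= d.
Proof.
move=> /andP[x0 x1] d0; have x1' : 0 < 1 - x by rewrite subr_gt0.
exists (Num.truncn (d * (1 - x))^-1).+1 => k k0k.
have kpos : 0 < k%:R :> R by rewrite ltr0n (leq_trans _ k0k).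
have big : (d * (1 - x))^-1 < k%:R.
  by apply: lt_le_trans (truncnS_gt _) _; rewrite ler_nat.
have := natr_mul_expr_le1 x k; rewrite x0 ltW // => /(_ isT) H.
rewrite -(ler_pM2l kpos) -(ler_pM2r x1'); apply: le_trans H _.
move: big; rewrite -[_^-1]mul1r ltr_pdivrMr ?mulr_gt0 // mulrA.
exact: ltW.
Qed.

(** One factor [(7/8)^k] reduces [C k + 2] to at most [8 C + 2], since [k (7/8)^k <= 8]; the other
    brings this constant below 1. *)
Lemma linear_mul_expr_le1 {R : realType} (C : nat) :
  exists k0, forall k, (k0 <= k)%N -> (7 / 8) ^+ (2 * k) * (C * k + 2)%:R <= 1 :> R.
Proof.
have C0 : 0 < 8 * C%:R + 2 :> R by have := ler0n R C; lra.
have [|//|k0 H] := @expr_eventually_le R (7 / 8) (8 * C%:R + 2)^-1.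
- lra.
- by rewrite invr_gt0.
exists k0 => k /H; rewrite -[X in _ <= X]mul1r ler_pdivlMr // => {}H.
apply: le_trans H; rewrite mulnC exprM expr2 -mulrA ler_wpM2l ?exprn_ge0 ?divr_ge0 //.
set x : R := (7 / 8) ^+ k.
have x0 : 0 <= x by rewrite exprn_ge0 ?divr_ge0.
have x1 : x <= 1 by rewrite exprn_ile1 //; lra.
have := @natr_mul_expr_le1 R (7 / 8) k; rewrite -/x => kx.
have {}kx : k%:R * x <= 8 by have /kx : 0 <= (7 / 8 : R) <= 1; lra.
rewrite natrD natrM; have := ler_wpM2l (ler0n R C) kx; lra.
Qed.

(** By [1 + t <= exp t] the product is at most [exp(p/3 - p (1 - e))] with [e = exp(-1/2)], and
    [e < 2/3] because [exp(1/2) > 3/2]. *)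
Lemma tilted_mean_lt1 {R : realType} (p : R) :
  0 < p -> expR (p / 3) * (1 - p + p * expR (- (1 / 2))) < 1.
Proof.
move=> p0; set e := expR (- _).
have e23 : e < 2 / 3.
  have := @expR_gt1Dx R (1 / 2); rewrite /e expRN => H.
  have {}H : 3 / 2 < expR (1 / 2) :> R by apply: le_lt_trans (H _); lra.
  by rewrite -[2 / 3]invf_div ltf_pV2 ?posrE ?expR_gt0 ?divr_gt0.
apply: (@le_lt_trans _ _ (expR (p / 3) * expR (- p * (1 - e)))).
  apply: ler_wpM2l; first exact: expR_ge0.
  by apply: le_trans (expR_ge1Dx _); lra.
rewrite -expRD expR_lt1; nra.
Qed.

(** * Choice of parameters and conclusion *)

Lemma exists_folkman_number (k l n : nat) : folkman_order k l n ->
  exists2 m, is_folkman_number k l m & (m <= n)%N.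
Proof.
move=> nP; have ex : exists m, `[< folkman_order k l m >] by exists n; apply/asboolP.
case: (ex_minnP ex) => m /asboolP mP mmin; exists m; last exact/mmin/asboolP.
by split=> // j /asboolP/mmin.
Qed.

(** With [n] the integer part of [B^(2k)], [(4n)^2 <= 16 B^(4k)], so the first two inequalities feed
    the union bound; the third leaves room for [2k] steps, as [(7B/8)^(2k) (s + 1) - 1 <= B^(2k) - 1
    < n]. *)
Lemma folkman_order_of_params {R : realType} (B : R) (k l s : nat) :
    let p := 24 / (7 * B) in
    let y := expR (p / 3) * (1 - p + p * expR (- (1 / 2))) in
    4 < B -> (0 < k)%N -> (0 < l)%N -> (0 < s)%N ->
    p ^+ l.-1 * (16 * B ^+ (4 * k)) <= 1 ->
    y ^+ s.-1 * (16 * B ^+ (4 * k)) <= 1 ->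
    (7 / 8) ^+ (2 * k) * s.+1%:R <= 1 :> R ->
  exists2 n, folkman_order k l n & n%:R <= B ^+ (2 * k).
Proof.
move=> p y B4 k0 l0 s0 pl ys sk.
have p0 : 0 < p by rewrite divr_gt0 //; lra.
have p1 : p < 1 by rewrite ltr_pdivrMr; lra.
have Bk1 : 1 <= B ^+ (2 * k) by rewrite exprn_ege1; lra.
have Bk0 : 0 <= B ^+ (2 * k) by apply: le_trans Bk1.
pose n := Num.truncn (B ^+ (2 * k)).
have nB : n%:R <= B ^+ (2 * k) by rewrite truncn_le.
have Bn : B ^+ (2 * k) < n%:R + 1 by rewrite natr1 truncnS_gt.
have n0 : (0 < n)%N by rewrite truncn_gt0.
exists n => //.
have y0 : 0 <= y.
  by rewrite mulr_ge0 ?expR_ge0 //; have := expR_ge0 (- (1 / 2) : R); nra.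
have sq : (4 * #|'I_n|%:R) ^+ 2 <= 16 * B ^+ (4 * k).
  rewrite card_ord exprMn (_ : 4 * k = 2 * k * 2)%N; last by lia.
  rewrite exprM; have : n%:R ^+ 2 <= (B ^+ (2 * k)) ^+ 2 by rewrite lerXn2r ?nnegrE.
  lra.
have [|||||||c [noK dense]] := @exists_clique_free_dense R 'I_n p y l s.
- by rewrite card_ord.
- by [].
- by [].
- by rewrite !ltW.
- by rewrite lexx ltW // tilted_mean_lt1.
- by apply: le_trans pl; rewrite ler_wpM2l // exprn_ge0 // ltW.
- by apply: le_trans ys; rewrite ler_wpM2l // exprn_ge0.
exists 'I_n, (graph_of c); split=> //; first by rewrite card_ord.
(* [D = 3/p], so that [D (2p/3) = 2], as the greedy lemma asks. *)
move=> chi; pose D := 7 * B / 8.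
have [||||A [b [_ Ak clA chA]]] := @mono_clique_of_dense R 'I_n (graph_of c) D s.+1%:R s
  chi _ _ _ k k setT.
- by rewrite /D; lra.
- by rewrite -natr1 addrK.
- move=> U sU U0; have [v vU dv] := exists_nbhd_ge R c U (2 * p / 3) U0 (dense U sU).
  exists v => //; have D0 : 0 <= D by rewrite /D; lra.
  apply: le_trans (ler_wpM2l D0 dv).
  rewrite (_ : D * _ = 2 * (#|U|%:R - 1)) // /D /p; field; lra.
- rewrite cardsT card_ord addnn -mul2n /D -mulrA [B / 8]mulrC mulrA exprMn.
  rewrite mulrAC; have := ler_piMl Bk0 sk; lra.
by exists A, b; split=> //; rewrite Ak; case: (b).
Qed.

Theorem theorem1p2 (R : realType) (alpha : R)
    (alpha_gt0 : 0 < alpha) (alpha_lt : alpha < 1 / 4) :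
  exists k0 : nat, forall k l : nat,
    (k0 <= k)%N -> k%:R <= alpha * l%:R ->
    exists n : nat, is_folkman_number k l n /\
      n%:R <= 2 `^ (4 * k%:R / (1 - 4 * alpha)).
Proof.
have a0 : 0 < 1 - 4 * alpha by lra.
pose B : R := 2 `^ (2 / (1 - 4 * alpha)).
have E4 : 4 = 2 `^ 2 :> R by rewrite (powR_mulrn 2) // -natrX.
(* The exponent in [B] is chosen so that [B^(1 - 4 alpha) = 4]. *)
have B4E : B / 4 = B `^ (4 * alpha).
  rewrite [X in _ / X]E4 /B -powRrM -powRB; last by rewrite pnatr_eq0 implybT.
  by congr (_ `^ _); field; lra.
have B4 : 4 < B.
  rewrite [X in X < _]E4.
  rewrite /B /powR pnatr_eq0 /= ltr_expR ltr_pM2r ?ln_gt0 ?ltr1n //.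
  by rewrite ltr_pdivlMr //; lra.
have B1 : 1 <= B by lra.
pose p := 24 / (7 * B).
pose y := expR (p / 3) * (1 - p + p * expR (- (1 / 2))).
have p0 : 0 < p by rewrite divr_gt0 //; lra.
have p1 : p < 1 by rewrite ltr_pdivrMr; lra.
have y0 : 0 <= y.
  by rewrite mulr_ge0 ?expR_ge0 //; have := expR_ge0 (- (1 / 2) : R); nra.
have B40 : 0 < 16 * B ^+ 4 by rewrite mulr_gt0 // exprn_gt0 //; lra.
(* With [s = C k + 1], the factor [y^(C k)] outweighs [16 B^(4k)]. *)
have [||C HC] := expr_eventually_le y (16 * B ^+ 4)^-1.
- by rewrite y0 tilted_mean_lt1.
- by rewrite invr_gt0.
have {}HC : y ^+ C * (16 * B ^+ 4) <= 1.
  by have := HC C (leqnn C); rewrite -[X in _ <= X]mul1r ler_pdivlMr.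
have [k1 Hk1] := @linear_mul_expr_le1 R C.
(* The [p] in the threshold pays for the exponent [l - 1] in place of [l]. *)
have [||k2 Hk2] := expr_eventually_le (6 / 7 : R) (p / 16).
- by lra.
- by rewrite divr_gt0.
exists (maxn 1 (maxn k1 k2)) => k l; rewrite !geq_max => /and3P[k0 kk1 kk2] kl.
have lek : (k <= l)%N.
  by rewrite -(ler_nat R); apply: le_trans kl _; rewrite ler_piMl //; lra.
have l0 : (0 < l)%N by apply: leq_trans lek.
have [||||n nF nB] := @folkman_order_of_params R B k l (C * k).+1 B4 k0 l0.
- by [].
- rewrite -/p -(ler_pM2l p0) mulr1 mulrA -exprS prednK //.
  (* Here [k <= alpha l] enters: [B^(4k) <= B^(4 alpha l)]. *)
  have BB : B ^+ (4 * k) <= (B / 4) ^+ l.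
    rewrite -!powR_mulrn ?divr_ge0 //; try lra.
    rewrite B4E -powRrM ler_powR // natrM; lra.
  apply: (@le_trans _ _ (p ^+ l * (16 * (B / 4) ^+ l))).
    by rewrite ler_wpM2l ?exprn_ge0 // ?(ltW p0) //; lra.
  rewrite mulrCA -exprMn (_ : p * (B / 4) = 6 / 7); last by rewrite /p; field; lra.
  have := Hk2 l (leq_trans kk2 lek); lra.
- rewrite -/p -/y /= exprM [X in _ * (_ * X)]exprM.
  (* Since [k >= 1], [16 <= 16^k], which completes a [k]-th power. *)
  apply: (@le_trans _ _ ((y ^+ C * (16 * B ^+ 4)) ^+ k)).
    rewrite [X in _ <= X]exprMn [X in _ <= _ * X]exprMn ler_wpM2l ?exprn_ge0 // ler_wpM2r ?exprn_ge0 //; first lra.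
    by rewrite -[X in X <= _]expr1 ler_weXn2l //; lra.
  by rewrite exprn_ile1 // mulr_ge0 ?exprn_ge0 // ltW.
- by have := Hk1 k kk1; rewrite addn2.
have [m mF mn] := exists_folkman_number _ _ _ nF.
exists m; split=> //; apply: (@le_trans _ _ n%:R); first by rewrite ler_nat.
apply: le_trans nB _; rewrite -powR_mulrn; last by lra.
rewrite /B -powRrM natrM le_eqVlt; apply/orP; left; apply/eqP; congr (_ `^ _).
by field; lra.
Qed.
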